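(* For every $r\in(1,\infty)$, the space $\mathrm{Diff}^{\mathrm{PL}}_{-\infty}(\mathbb R)$ is totally geodesic in $\mathrm{biLip}^{1,1}_{-\infty}(\mathbb R)$ with respect to the flow of the $r$-Hunter--Saxton equation. That is, any solution whose initial velocity $u_0\in\mathfrak{lip}^{1,1}_{-\infty}(\mathbb R)$ is piecewise linear remains in $\mathrm{Diff}^{\mathrm{PL}}_{-\infty}(\mathbb R)$ as long as the flow exists.
   Context: $\dot W^{1,1}(\mathbb R)$ is the space of functions on $\mathbb R$ with integrable derivative. The group of integrable bi-Lipschitz homeomorphisms is $$\mathrm{biLip}^{1,1}_{-\infty}(\mathbb R)=\{\varphi=\mathrm{id}+f:\ \varphi\text{ invertible},\ \varphi^{-1}=\mathrm{id}+g,\ f,g\in\dot W^{1,1}(\mathbb R)\cap W^{1,\infty}(\mathbb R),\ \lim_{x\to-\infty}f(x)=0\},$$ with Lie algebra $\mathfrak{lip}^{1,1}_{-\infty}(\mathbb R)=\{u\in W^{1,\infty}(\mathbb R)\cap\dot W^{1,1}(\mathbb R):\ \lim_{x\to-\infty}u(x)=0\}$. The piecewise-linear subset is $$\mathrm{Diff}^{\mathrm{PL}}_{-\infty}(\mathbb R)=\{\varphi=\mathrm{id}+f\in\mathrm{biLip}^{1,1}_{-\infty}(\mathbb R):\ f'\text{ is piecewise constant}\}.$$ The flow of the $r$-Hunter--Saxton equation is understood in Lagrangian form, as the geodesic flow of the right-invariant Finsler metric $F_\varphi(h)=\left(\int_{\mathbb R}|(h\circ\varphi^{-1})'|^r\,dx\right)^{1/r}$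 on $\mathrm{biLip}^{1,1}_{-\infty}(\mathbb R)$. The solution with $\varphi(0)=\mathrm{id}$ and initial velocity $\varphi_t(0)=u_0\in\mathfrak{lip}^{1,1}_{-\infty}(\mathbb R)$ is given by $$\varphi(t,x)=x+\int_{-\infty}^x\left(\left(\frac{t\,u_0'(y)}{r}+1\right)^r-1\right)dy,$$ for as long as it stays in $\mathrm{biLip}^{1,1}_{-\infty}(\mathbb R)$. *)

(* Defs.v *)
From HB Require Import structures.
From mathcomp Require Import all_boot all_order all_algebra.
From mathcomp Require Import all_classical all_reals all_analysis.

Set Implicit Arguments.
Unset Strict Implicit.
Unset Printing Implicit Defensive.
Import Order.TTheory GRing.Theory Num.Theory.
Import numFieldNormedType.Exports.

Local Open Scope ring_scope.
Local Open Scope classical_set_scope.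

(** MathComp-Analysis world. Functions on the line are genuine functions
    [R -> R]: a Sobolev class with one weak derivative is represented by its
    locally absolutely continuous member, and its weak derivative by the
    pointwise derivative [derive1 f], which exists almost everywhere. At the
    remaining points [derive1 f] has a junk value; they form a null set. *)

Definition locally_absolutely_continuous (R : realType) (f : R -> R) : Prop :=
  locally_integrable setT (derive1 f) /\
  forall a b : R, a <= b ->
    f b - f a = \int[lebesgue_measure]_(x in `[a, b]) derive1 f x.

(** The homogeneous space: [f] itself need not be integrable. *)
Definition Wdot11 (R : realType) (f : R -> R) : Prop :=
  locally_absolutely_continuous f /\ derive1 f \in Lfun lebesgue_measure 1%E.

Definition W1oo (R : realType) (f : R -> R) : Prop :=
  [/\ locally_absolutely_continuous f,
      f \in Lfun lebesgue_measure +oo%E &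
      derive1 f \in Lfun lebesgue_measure +oo%E].

Definition lip11 (R : realType) (u : R -> R) : Prop :=
  [/\ W1oo u, Wdot11 u & u x @[x --> -oo] --> (0 : R)].

Definition displacement (R : realType) (phi : R -> R) : R -> R :=
  fun x => phi x - x.

Definition biLip11 (R : realType) (phi : R -> R) : Prop :=
  exists psi : R -> R,
    [/\ cancel phi psi /\ cancel psi phi,
        Wdot11 (displacement phi) /\ W1oo (displacement phi),
        Wdot11 (displacement psi) /\ W1oo (displacement psi) &
        displacement phi x @[x --> -oo] --> (0 : R)].

(** Finitely many breakpoints [s]; the value at a breakpoint is irrelevant.
    The two unbounded pieces are covered because they are increasing unions of
    bounded intervals (a, b). *)
Definition piecewise_constant (R : realType) (g : R -> R) : Prop :=
  exists s : seq R, forall a b : R, a < b ->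
    (forall c : R, c \in s -> c <= a \/ b <= c) ->
    exists k : R, forall x : R, a < x < b -> g x = k.

Definition piecewise_linear (R : realType) (f : R -> R) : Prop :=
  exists s : seq R, forall a b : R, a < b ->
    (forall c : R, c \in s -> c <= a \/ b <= c) ->
    exists k m : R, forall x : R, a < x < b -> f x = k * x + m.

Definition DiffPL (R : realType) (phi : R -> R) : Prop :=
  biLip11 phi /\ piecewise_constant (derive1 (displacement phi)).

(** Explicit geodesic of the right-invariant metric
    [F_phi(h) = (\int |(h \o phi^-1)'|^r)^(1/r)] starting at the identity with
    velocity [u0]: [phi |-> r ((phi')^(1/r) - 1)] is an isometry into [L^r], so
    [(phi')^(1/r)] moves along the straight line [t u0' / r + 1]. *)
Definition rHS_flow (R : realType) (r : R) (u0 : R -> R) (t : R) : R -> R :=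
  fun x => x + \int[lebesgue_measure]_(y in `]-oo, x])
                 ((t * derive1 u0 y / r + 1) `^ r - 1).

(** [phi] solves the r-Hunter-Saxton equation on the time interval [I].
    Since [I] is an interval containing [0], the flow has to stay in the group
    on the whole way from [0] to [t]; in particular [t u0' / r + 1] is positive
    almost everywhere for every [t] in [I], so the conventional value of [`^]
    on negative arguments plays no role. *)
Definition rHS_solution (R : realType) (r : R) (u0 : R -> R) (I : interval R)
    (phi : R -> R -> R) : Prop :=
  0 \in I /\
  forall t : R, t \in I -> biLip11 (phi t) /\ phi t = rHS_flow r u0 t.

(* Main.v *)
(** On a piece where [u0'] is constant, so is the integrand
    [(t u0' / r + 1)^r - 1] of the explicit geodesic; the displacement is
    therefore affine on the same pieces as [u0], for every [t]. *)
Require Import Defs.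
From HB Require Import structures.
From mathcomp Require Import all_boot all_order all_algebra.
From mathcomp Require Import all_classical all_reals all_analysis.
From mathcomp Require Import measurable_realfun ring lra.
Import Order.TTheory GRing.Theory Num.Theory.
Import numFieldNormedType.Exports.
Local Open Scope classical_set_scope.
Local Open Scope ring_scope.

(** Cut the half-line at [m]. The integrals stay in the extended reals, where additivity over
    disjoint sets asks only for measurability, so the term up to [m] may be infinite. *)
Lemma integral_Nyitv_cst (R : realType) (f : R -> R) (m x c : R) :
    m <= x -> measurable_fun [set: R] f -> (forall y, m < y <= x -> f y = c) ->
  (\int[lebesgue_measure]_(y in `]-oo, x]) (f y)%:E =
   \int[lebesgue_measure]_(y in `]-oo, m]) (f y)%:E + (c * (x - m))%:E)%E.
Proof.
move=> mx mf fc.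
have -> : `]-oo, x]%classic = `]-oo, m]%classic `|` `]m, x]%classic :> set R.
  by rewrite (@itv_bndbnd_setU _ _ _ (BRight m))// bnd_simp.
rewrite integral_setU//=; last 2 first.
- by apply/measurable_EFinP; exact: measurable_funTS.
- apply/disj_setPS => y [] /=; rewrite !in_itv/= => ym /andP[my _].
  by move: (lt_le_trans my ym); rewrite ltxx.
congr (_ + _)%E.
rewrite (eq_integral (cst c%:E)); last first.
  by move=> y; rewrite inE/= in_itv/= => /fc ->.
rewrite integral_cst//= lebesgue_measure_itv/= lte_fin.
(* The length formula tests [m < x]; when the test fails, [m <= x] forces [x = m] and the added term
   vanishes. *)
case: ltP => xm; first by rewrite -EFinB -EFinM.
by rewrite mule0 (_ : x - m = 0) ?mulr0//; lra.
Qed.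

(** Differentiation is local, and each point of an open piece has a neighbourhood inside it. This
    serves both for [u0] and for the integral up to [x]. *)
Lemma derive1_affine (R : realType) (f : R -> R) (a b k m : R) :
    (forall x, a < x < b -> f x = k * x + m) ->
  forall x, a < x < b -> derive1 f x = k.
Proof.
move=> fE x xab.
have /near_eq_derive : {near x, f =1 (fun y => k * y + m)}.
  have : \forall y \near x, y \in `]a, b[ by apply: near_in_itvoo; rewrite in_itv.
  by apply: filterS => y; rewrite in_itv/=; exact: fE.
rewrite derive1E => ->.
by rewrite derive_val addr0 [k%:A]mulr1.
Qed.

(** [h] need not be integrable near [-oo]: then the extended integral is infinite
    at every point of a piece, or at none, and [Rintegral] has the junk value [0]
    on the whole piece. *)
Lemma piecewise_constant_derive1_integral (R : realType) (h : R -> R) :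
    measurable_fun [set: R] h -> piecewise_constant h ->
  piecewise_constant
    (derive1 (fun x => \int[lebesgue_measure]_(y in `]-oo, x]) h y)).
Proof.
move=> mh [s hs]; exists s => a b ab /(hs _ _ ab)[c hc].
(* Any interior point would do as the common reference for the piece. *)
pose m := (a + b) / 2.
pose E x := (\int[lebesgue_measure]_(y in `]-oo, x]) (h y)%:E)%E.
have EE x : a < x < b -> E x = (E m + (c * (x - m))%:E)%E.
  move=> /andP[ax xb]; case: (leP m x) => mx.
    apply: integral_Nyitv_cst => // y /andP[my yx].
    by apply: hc; rewrite /m in my; lra.
  (* Left of [m] the roles swap: [E m] is expanded from [E x]. The two corrections are real numbers,
     so they cancel even if [E x] is infinite. *)
  rewrite [E m](@integral_Nyitv_cst _ h x m c) ?(ltW mx)//; last first.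
    by move=> y /andP[xy ym]; apply: hc; rewrite /m in ym; lra.
  rewrite -addeA -EFinD -mulrDr (_ : m - x + (x - m) = 0) ?mulr0 ?adde0//; ring.
have [Em|] := boolP (E m \is a fin_num).
- exists c; apply: (@derive1_affine _ _ _ _ c (fine (E m) - c * m)) => x xab.
  by rewrite /Rintegral -/(E x) EE// fineD//=; ring.
- move=> Em; exists 0; apply: (@derive1_affine _ _ _ _ 0 0) => x xab.
  by rewrite mul0r addr0 /Rintegral -/(E x) EE//; move: Em; case: (E m).
Qed.

Theorem corollary2p7p1 (R : realType) (r : R) (hr : 1 < r) (u0 : R -> R)
    (hu0 : lip11 u0) (hPL : piecewise_linear u0)
    (I : interval R) (phi : R -> R -> R)
    (hphi : rHS_solution r u0 I phi) :
  forall t : R, t \in I -> DiffPL (phi t).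
Proof.
move=> t tI; have [biLip phiE] := hphi.2 t tI; split=> //.
(* Measurability is part of the membership of [derive1 u0] in $L^1$. *)
have mu0 : measurable_fun [set: R] (derive1 u0).
  by have [_ [_ /andP[]]] := hu0; rewrite inE.
have -> : displacement (phi t) = fun x =>
    \int[lebesgue_measure]_(y in `]-oo, x]) ((t * derive1 u0 y / r + 1) `^ r - 1).
  by apply/funext => x; rewrite /displacement phiE /rHS_flow addrAC subrr add0r.
apply: piecewise_constant_derive1_integral.
  apply: measurable_funB => //; apply: (measurableT_comp (@measurable_powR R r)).
  by apply: measurable_funD => //; do 2 apply: measurable_funM => //.
have [s hs] := hPL; exists s => a b ab /(hs _ _ ab)[k [m u0E]].
exists ((t * k / r + 1) `^ r - 1) => x xab.
by rewrite (derive1_affine _ _ _ _ _ _ u0E).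
Qed.
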